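(* Let $G_1$ be a finite, simple, connected, non-complete graph and let $G_2$ be a finite simple graph. (1) If $G_2$ is connected, then $G_1\circ G_2$ is not super connected. (2) If $G_2$ is disconnected and $|V_0(G_2)|=0$, then $G_1\circ G_2$ is not super connected. (3) If $G_2$ is disconnected with $|V_0(G_2)|\geq 1$ and $G_1$ is super connected, then $G_1\circ G_2$ is super connected.
   Context: All graphs are finite, simple and undirected. For a graph $H$, $V_0(H)$ denotes the set of isolated vertices (vertices of degree $0$) of $H$. For a graph $G$, a set $S\subseteq V(G)$ is a vertex-cut of $G$ if $G-S$ is disconnected or $G-S$ is the trivial graph $K_1$; a minimum vertex-cut is a vertex-cut of minimum cardinality. A graph $G$ is super connected if every minimum vertex-cut $S$ of $G$ isolates a vertex, i.e. $G-S$ has an isolated vertex. The lexicographic product $G_1\circ G_2$ has vertex set $V(G_1)\times V(G_2)$, where $(x_1,y_1)$ and $(x_2,y_2)$ are adjacent if and only if either $x_1x_2\in E(G_1)$, or $x_1=x_2$ and $y_1y_2\in E(G_2)$.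
   Formalization: Part (1) additionally assumes that G_2 has at least two vertices; for G_2 = K_1 the claim fails, since G_1∘K_1 is isomorphic to G_1 and, for example, the path P_3 is connected, non-complete and super connected. *)

(* Defs.v *)
From mathcomp Require Import all_boot.

Set Implicit Arguments.
Unset Strict Implicit.
Unset Printing Implicit Defensive.

Record sgraph := SGraph {
  vertex :> finType;
  adj : rel vertex;
  adj_sym : symmetric adj;
  adj_irrefl : irreflexive adj }.

Section Notions.
Variable G : sgraph.

Definition degree (x : G) : nat := #|[set y | adj x y]|.

Definition V0 : {set G} := [set x | degree x == 0].

Definition complete : Prop := forall x y : G, x != y -> adj x y.

(* The null graph (reachable as G - V(G)) is neither connected nor
   disconnected; K_1 is connected. *)
Definition connected : Prop :=
  0 < #|G| /\ forall x y : G, connect (@adj G) x y.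

Definition disconnected : Prop :=
  exists x y : G, ~~ connect (@adj G) x y.

Definition trivial : Prop := #|G| = 1.

End Notions.

Section Delete.
Variables (G : sgraph) (S : {set G}).

Definition delete_adj : rel {x : G | x \notin S} :=
  fun x y => adj (val x) (val y).

Lemma delete_adj_sym : symmetric delete_adj.
Proof. by move=> x y; rewrite /delete_adj adj_sym. Qed.

Lemma delete_adj_irrefl : irreflexive delete_adj.
Proof. by move=> x; rewrite /delete_adj adj_irrefl. Qed.

Definition delete : sgraph := SGraph delete_adj_sym delete_adj_irrefl.

End Delete.

Section Cuts.
Variable G : sgraph.

Definition vertex_cut (S : {set G}) : Prop :=
  disconnected (delete S) \/ trivial (delete S).

Definition min_vertex_cut (S : {set G}) : Prop :=
  vertex_cut S /\ forall S' : {set G}, vertex_cut S' -> #|S| <= #|S'|.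

Definition super_connected : Prop :=
  forall S : {set G}, min_vertex_cut S ->
    exists x : delete S, x \in V0 (delete S).

End Cuts.

Section Lex.
Variables G1 G2 : sgraph.

Definition lex_adj : rel (G1 * G2) :=
  fun u v => adj u.1 v.1 || (u.1 == v.1) && adj u.2 v.2.

Lemma lex_adj_sym : symmetric lex_adj.
Proof.
by move=> u v; rewrite /lex_adj (adj_sym u.1) (adj_sym u.2) (eq_sym u.1).
Qed.

Lemma lex_adj_irrefl : irreflexive lex_adj.
Proof. by move=> u; rewrite /lex_adj !adj_irrefl andbF. Qed.

Definition lex_product : sgraph := SGraph lex_adj_sym lex_adj_irrefl.

End Lex.

(* Main.v *)
Require Import Defs.
From mathcomp Require Import all_boot.

Set Implicit Arguments.
Unset Strict Implicit.
Unset Printing Implicit Defensive.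

(** If [S] is a vertex-cut of [G1 o G2], the set [T] of all [x] whose fibre
    [{x} * V(G2)] lies inside [S] is a vertex-cut of [G1]: when [G1 - T] is
    connected with at least two vertices, any two vertices left over by [S] are
    joined, those in a common fibre through a neighbouring fibre.  Conversely
    [T * V(G2)] is a vertex-cut whenever [G1 - T] is disconnected, and this holds
    for each minimum vertex-cut [T] because [G1] is not complete.  Hence the
    minimum vertex-cuts of [G1 o G2] are exactly the sets [T * V(G2)] with [T] a
    minimum vertex-cut of [G1].  As [G1 o G2 - T * V(G2) = (G1 - T) o G2], whose
    isolated vertices are the pairs of isolated vertices, the claims follow. *)

Lemma V0P (G : sgraph) (x : G) : reflect (forall y, ~~ adj x y) (x \in V0 G).
Proof.
rewrite inE /degree cards_eq0; apply: (iffP eqP) => [N0 y | N].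
  by move/setP/(_ y): N0; rewrite !inE => ->.
by apply/setP=> z; rewrite !inE (negbTE (N z)).
Qed.

(** A path from an isolated vertex never leaves it, so connectedness would make it the only
    vertex. *)
Lemma connected_V0 (G : sgraph) : connected G -> 1 < #|G| -> #|V0 G| = 0.
Proof.
move=> [_ conG] /card_gt1P[x [y [_ _ neq_xy]]].
apply/eqP; rewrite cards_eq0; apply/eqP/setP=> z; rewrite in_set0.
apply/negP=> /V0P isoz.
have eqz w : z = w.
  by have /connectP[[|v p] //= /andP[zv _] _] := conG z w; case/negP: (isoz v).
by case/eqP: neq_xy; rewrite -(eqz x) (eqz y).
Qed.

(** * Vertex-cuts described by separating sets *)

Section Delete.
Variables (G : sgraph) (S : {set G}).

(** Take [A] to be the component of [x]; conversely, a path cannot leave a closed set. This form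
    avoids paths and the subtype of remaining vertices. *)
Lemma delete_disconnectedP :
  disconnected (delete S) <->
  exists A : {set G}, [/\ exists2 x, x \notin S & x \in A,
    exists2 y, y \notin S & y \notin A &
    forall x y, x \notin S -> y \notin S -> adj x y -> (x \in A) = (y \in A)].
Proof.
split=> [[x [y Nxy]] | [A [[x Sx Ax] [y Sy Ay] clA]]].
  exists [set val z | z in connect (@adj (delete S)) x]; split.
  - exists (val x); first exact: (valP x).
    by apply: imset_f; apply: (connect0 (@adj (delete S)) x).
  - exists (val y); first exact: (valP y).
    by rewrite (mem_imset _ _ val_inj).
  - have sub u v (Su : u \notin S) (Sv : v \notin S) : adj u v ->
        u \in [set val z | z in connect (@adj (delete S)) x] ->
        v \in [set val z | z in connect (@adj (delete S)) x].
      move=> uv /imsetP[z xz Du]; apply/imsetP; exists (Sub v Sv) => //.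
      by apply: connect_trans xz (connect1 _); rewrite /= /delete_adj -Du.
    move=> u v Su Sv uv; apply/idP/idP; apply: sub => //.
    by rewrite adj_sym.
exists (Sub x Sx), (Sub y Sy); apply/negP=> xy.
have cl : closed (@adj (delete S)) [pred z | val z \in A].
  by move=> u v uv; rewrite !inE; apply: clA => //; [exact: (valP u) | exact: (valP v)].
by have := closed_connect cl xy; rewrite !inE /= Ax (negbTE Ay).
Qed.

Lemma delete_trivialE : trivial (delete S) <-> #|~: S| = 1.
Proof.
have -> : ~: S = [set x | x \notin S] by apply/setP=> x; rewrite !inE.
by rewrite /trivial card_sig cardsE.
Qed.

(** Boolean form of [vertex_cut], so that [arg_minnP] can select a smallest cut. *)
Definition vertex_cutb : bool :=
  [exists x : delete S, exists y, ~~ connect (@adj (delete S)) x y]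
  || (#|delete S| == 1).

Lemma vertex_cutP : reflect (vertex_cut S) vertex_cutb.
Proof.
apply: (iffP orP) => -[H|H].
- by left; case/existsP: H => x /existsP[y]; exists x, y.
- by right; apply/eqP.
- by left; case: H => x [y Nxy]; apply/existsP; exists x; apply/existsP; exists y.
- by right; apply/eqP.
Qed.

End Delete.

Lemma V0_deleteP (G : sgraph) (S : {set G}) :
  (exists x : delete S, x \in V0 (delete S)) <->
  exists2 x, x \notin S & forall y, y \notin S -> ~~ adj x y.
Proof.
split=> [[x /V0P isox] | [x Sx isox]].
  exists (val x); first exact: (valP x).
  by move=> y Sy; apply: (isox (Sub y Sy)).
by exists (Sub x Sx); apply/V0P => y; apply: (isox _ (valP y)).
Qed.

(** * Minimum vertex-cuts of non-complete graphs *)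

Section NonComplete.
Variable G : sgraph.
Hypothesis ncG : ~ complete G.

Lemma noncompleteP : exists x y : G, x != y /\ ~~ adj x y.
Proof.
case: (boolP [exists x : G, exists y, (x != y) && ~~ adj x y]).
  by case/existsP=> x /existsP[y /andP[]]; exists x, y.
move/existsPn=> H; case: ncG => x y neq_xy.
by move/existsPn: (H x) => /(_ y); rewrite neq_xy negbK.
Qed.

(** Delete everything except two non-adjacent vertices. *)
Lemma noncomplete_cut : exists S : {set G}, vertex_cut S /\ #|~: S| = 2.
Proof.
have [x [y [neq_xy Nxy]]] := noncompleteP.
exists (~: [set x; y]); rewrite setCK cards2 neq_xy; split=> //; left.
apply/delete_disconnectedP; exists [set x]; split.
- by exists x; rewrite !inE ?eqxx.
- by exists y; rewrite !inE ?eqxx ?orbT // eq_sym.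
- move=> u v; rewrite !inE !negbK.
  by move=> /orP[]/eqP-> /orP[]/eqP->; rewrite ?(negbTE Nxy) // adj_sym (negbTE Nxy).
Qed.

Lemma min_vertex_cut_exists : exists S : {set G}, min_vertex_cut S.
Proof.
have [S0 [/vertex_cutP cutS0 _]] := noncomplete_cut.
case: (arg_minnP (fun S : {set G} => #|S|) cutS0) => S /vertex_cutP cutS minS.
by exists S; split=> // S' /vertex_cutP; apply: minS.
Qed.

(** A cut leaving a single vertex has one element more than the cut of [noncomplete_cut], so it is
    not minimum. *)
Lemma min_vertex_cut_disconnected (S : {set G}) :
  min_vertex_cut S -> disconnected (delete S).
Proof.
move=> [[//|/delete_trivialE S1] minS].
have [S0 [/minS leS S02]] := noncomplete_cut.
have := cardsC S; rewrite -(cardsC S0) S1 S02 => DS.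
by move: leS; rewrite -(leq_add2r 1) DS addnS addn1 ltnn.
Qed.

End NonComplete.

(** * Vertex-cuts of the lexicographic product *)

Section LexProduct.
Variables G1 G2 : sgraph.
Local Notation P := (lex_product G1 G2).

Definition cylinder (T : {set G1}) : {set P} := setX T [set: G2].

Lemma in_cylinder (T : {set G1}) (u : P) : (u \in cylinder T) = (u.1 \in T).
Proof. by case: u => x y; rewrite in_setX in_setT andbT. Qed.

Lemma card_cylinder (T : {set G1}) : #|cylinder T| = #|T| * #|G2|.
Proof. by rewrite cardsX cardsT. Qed.

Definition full_fibres (S : {set P}) : {set G1} :=
  [set x | [forall y, (x, y) \in S]].

Lemma full_fibresPn (S : {set P}) (x : G1) :
  reflect (exists y, (x, y) \notin S) (x \notin full_fibres S).
Proof. by rewrite inE; apply: (iffP forallPn). Qed.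

Lemma cylinder_full_fibres (S : {set P}) : cylinder (full_fibres S) \subset S.
Proof.
by apply/subsetP=> -[x y]; rewrite in_cylinder inE => /forallP/(_ y).
Qed.

Lemma vertex_cut_cylinder (T : {set G1}) :
  0 < #|G2| -> disconnected (delete T) -> vertex_cut (cylinder T).
Proof.
move=> /card_gt0P[y0 _] /delete_disconnectedP[A [[x Tx Ax] [y Ty Ay] clA]].
left; apply/delete_disconnectedP; exists (cylinder A); split.
- by exists (x, y0); rewrite in_cylinder.
- by exists (y, y0); rewrite in_cylinder.
- move=> u v; rewrite !in_cylinder => Tu Tv /orP[|/andP[/eqP->]] //.
  exact: clA.
Qed.

Lemma vertex_cut_full_fibres (S : {set P}) :
  vertex_cut S -> vertex_cut (full_fibres S).
Proof.
case=> [/delete_disconnectedP | /delete_trivialE/eqP/cards1P[[x y] DS]]; last first.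
  right; apply/delete_trivialE/eqP/cards1P; exists x.
  have inS u : (u \notin S) = (u == (x, y)) by rewrite -in_setC DS inE.
  apply/setP=> z; rewrite in_setC in_set1; apply/full_fibresPn/eqP=> [[w]|->].
    by rewrite inS => /eqP[].
  by exists y; rewrite inS.
move=> [A [[[x y] Sxy Axy] [[x' y'] Sxy' Axy'] clA]].
(* A mixed fibre has surviving vertices both inside and outside [A]. *)
pose mixed z := [exists w, exists w',
  [&& (z, w) \notin S, (z, w) \in A, (z, w') \notin S & (z, w') \notin A]].
case: (pickP mixed) => [z /existsP[w /existsP[w' /and4P[Sw Aw Sw' Aw']]] | unmixed].
  (* A surviving vertex over a neighbour of [z] would be adjacent to both sides of the mixed fibre.
     So [z] is isolated once the full fibres are removed: it is split off from any other remaining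
     vertex, or is the only one. *)
  have isoz v : v \notin full_fibres S -> ~~ adj z v.
    case/full_fibresPn=> t St; apply/negP=> zv.
    have Dt a : (z, a) \notin S -> ((z, a) \in A) = ((v, t) \in A).
      by move=> Sa; apply: clA => //; apply/orP; left.
    by case/negP: Aw'; rewrite (Dt w') // -(Dt w).
  have Tz : z \notin full_fibres S by apply/full_fibresPn; exists w.
  case: (pickP [pred v | (v != z) && (v \notin full_fibres S)]) => [v | only_z].
    case/andP=> neq_vz Tv; left; apply/delete_disconnectedP; exists [set z].
    split; [by exists z; rewrite ?in_set1 | by exists v; rewrite ?in_set1 | ].
    move=> a b Ta Tb ab; rewrite !inE; apply/eqP/eqP=> Dz.
      by case/negP: (isoz b Tb); rewrite -Dz.
    by case/negP: (isoz a Ta); rewrite adj_sym -Dz.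
  right; apply/delete_trivialE/eqP/cards1P; exists z; apply/setP=> v.
  rewrite in_setC in_set1; have := only_z v; rewrite /=.
  by case: eqP => [->|_ /= ->].
(* With no mixed fibre, each surviving fibre lies on one side of [A], so the projection [B] of the
   part of [A] outside [S] separates [G1]. *)
pose B := [set z | [exists w, ((z, w) \notin S) && ((z, w) \in A)]].
have notB z w : (z, w) \notin S -> (z, w) \notin A -> z \notin B.
  move=> Sw Aw; rewrite inE; apply/existsPn=> t; apply/negP=> /andP[St At].
  have /existsPn/(_ t)/existsPn/(_ w) := negbT (unmixed z).
  by rewrite St At Sw Aw.
left; apply/delete_disconnectedP; exists B; split.
- exists x; first by apply/full_fibresPn; exists y.
  by rewrite inE; apply/existsP; exists y; rewrite Sxy.
- exists x'; first by apply/full_fibresPn; exists y'.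
  exact: (notB _ y').
- have sub a b : b \notin full_fibres S -> adj a b -> a \in B -> b \in B.
    case/full_fibresPn=> t St ab; rewrite inE => /existsP[w /andP[Sw Aw]].
    rewrite inE; apply/existsP; exists t; rewrite St -(clA (a, w)) //.
    by apply/orP; left.
  move=> a b Ta Tb ab; apply/idP/idP; first exact: sub.
  by apply: sub => //; rewrite adj_sym.
Qed.

Lemma min_vertex_cut_lex (S : {set P}) : ~ complete G1 -> 0 < #|G2| ->
  min_vertex_cut S <-> exists2 T, min_vertex_cut T & S = cylinder T.
Proof.
move=> ncG1 G2_gt0; split=> [[cutS minS] | [T minT ->]]; last first.
  split; first exact/vertex_cut_cylinder/min_vertex_cut_disconnected.
  (* Any cut [S'] contains the cylinder over its full fibres, whose base is a cut of [G1] and hence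
     at least as large as [T]. *)
  move=> S' /vertex_cut_full_fibres/(proj2 minT) leT.
  apply: leq_trans (subset_leq_card (cylinder_full_fibres S')).
  by rewrite !card_cylinder leq_mul2r leT orbT.
have [T0 minT0] := min_vertex_cut_exists ncG1.
(* Squeeze [#|S|] between the cylinders over [full_fibres S] and [T0]: cancelling [#|G2|] makes
   [full_fibres S] minimum, and inclusion with equal cardinality gives equality. *)
have leST0 : #|S| <= #|T0| * #|G2|.
  rewrite -card_cylinder; apply: minS.
  exact/vertex_cut_cylinder/min_vertex_cut_disconnected.
have cutT := vertex_cut_full_fibres cutS.
have leTS := subset_leq_card (cylinder_full_fibres S).
exists (full_fibres S).
  split=> // T' /(proj2 minT0); apply: leq_trans.
  by rewrite -(leq_pmul2r G2_gt0) -card_cylinder (leq_trans leTS).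
apply/esym/eqP; rewrite eqEcard cylinder_full_fibres card_cylinder /=.
by apply: leq_trans leST0 _; rewrite leq_mul2r (proj2 minT0) ?orbT.
Qed.

Lemma lex_not_super_connected :
  ~ complete G1 -> 0 < #|G2| -> #|V0 G2| = 0 -> ~ super_connected P.
Proof.
move=> ncG1 G2_gt0 /eqP; rewrite cards_eq0 => /eqP noV0 superP.
have [T minT] := min_vertex_cut_exists ncG1.
have minS : min_vertex_cut (cylinder T).
  by apply/min_vertex_cut_lex => //; exists T.
have /V0_deleteP[[x y]] := superP _ minS; rewrite in_cylinder => Tx isoxy.
(* The fibre over [x] survives entirely, so a neighbour of [y] would give one of [(x, y)]. *)
have: y \in V0 G2.
  apply/V0P=> z; apply/negP=> yz.
  have := isoxy (x, z); rewrite in_cylinder => /(_ Tx).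
  by rewrite /= /lex_adj /= eqxx yz orbT.
by rewrite noV0 inE.
Qed.

Lemma lex_super_connected :
  ~ complete G1 -> 0 < #|V0 G2| -> super_connected G1 -> super_connected P.
Proof.
move=> ncG1 /card_gt0P[y /V0P isoy] superG1 S /min_vertex_cut_lex[//||T minT ->].
  by apply/card_gt0P; exists y.
have /V0_deleteP[x Tx isox] := superG1 T minT.
apply/V0_deleteP; exists (x, y); first by rewrite in_cylinder.
move=> [x' y']; rewrite in_cylinder => Tx'.
by rewrite /= /lex_adj /= (negbTE (isox _ Tx')) (negbTE (isoy _)) andbF.
Qed.

End LexProduct.

Theorem theorem2p5 (G1 G2 : sgraph)
    (G1_connected : connected G1) (G1_noncomplete : ~ complete G1) :
  [/\ connected G2 -> 1 < #|G2| ->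
        ~ super_connected (lex_product G1 G2),
      disconnected G2 -> #|V0 G2| = 0 ->
        ~ super_connected (lex_product G1 G2)
    & disconnected G2 -> 1 <= #|V0 G2| -> super_connected G1 ->
        super_connected (lex_product G1 G2)].
Proof.
split=> [conG2 G2_gt1 | [y _] noV0 | _].
- by apply: lex_not_super_connected; rewrite ?connected_V0 // ltnW.
- by apply: lex_not_super_connected => //; apply/card_gt0P; exists y.
- exact: lex_super_connected.
Qed.
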